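(* The class of multi-path matroids is closed under contraction: if $M$ is a multi-path matroid and $x$ is an element of $M$, then $M/x$ is a multi-path matroid.
   Context: Transversal matroid $M[\mathcal{A}]$ of a multiset $\mathcal{A}=(A_j:j\in J)$ of subsets of a finite set $S$: independent sets are the sets $\{x_k:k\in K\}$ of $|K|$ distinct elements with $K\subseteq J$, $x_k\in A_k$; $\mathcal{A}$ is a presentation. For a cyclic permutation $\sigma$ of $S$, a $\sigma$-interval is a nonempty set $\{f,\sigma(f),\ldots,l\}$. A multi-path matroid is a transversal matroid with a presentation by an antichain (no member containing another) of $\sigma$-intervals for some cyclic permutation $\sigma$ of its ground set. *)

(* Defs.v *)
From mathcomp Require Import all_boot all_fingroup.

Set Implicit Arguments.
Unset Strict Implicit.
Unset Printing Implicit Defensive.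

(* Matroids live on a subset [ground] of an ambient finite type, so that a
   matroid and its minors have the same type. *)
Record matroid (T : finType) := Matroid {
  ground : {set T};
  indep : {set {set T}};
  indep_ground : forall I : {set T}, I \in indep -> I \subset ground;
  indep_set0 : set0 \in indep;
  indep_hereditary : forall I J : {set T},
    J \in indep -> I \subset J -> I \in indep;
  indep_augment : forall I J : {set T},
    I \in indep -> J \in indep -> #|I| < #|J| ->
    exists2 y, y \in J :\: I & y |: I \in indep
}.

Section Contraction.
Variables (T : finType) (M : matroid T) (x : T).

(* If x is a loop, M/x is the deletion of x. *)
Definition contract_indep : {set {set T}} :=
  [set I : {set T} | (x \notin I) &&
     (if [set x] \in indep M then x |: I \in indep M else I \in indep M)].

Lemma contract_indep_ground (I : {set T}) :
  I \in contract_indep -> I \subset ground M :\ x.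
Proof.
rewrite inE subsetD1 => /andP[-> HI]; rewrite andbT.
case: ifP HI => _ /indep_ground //.
by apply: subset_trans; apply: subsetUr.
Qed.

Lemma contract_indep_set0 : set0 \in contract_indep.
Proof.
rewrite inE in_set0 setU0 /=; case: ifP => // _.
exact: indep_set0.
Qed.

Lemma contract_indep_hereditary (I J : {set T}) :
  J \in contract_indep -> I \subset J -> I \in contract_indep.
Proof.
rewrite !inE => /andP[xJ HJ] sIJ.
rewrite (contra (subsetP sIJ x) xJ) /=.
case: ifP HJ => _ HJ; apply: indep_hereditary HJ _ => //.
exact: setUS.
Qed.

Lemma contract_indep_augment (I J : {set T}) :
  I \in contract_indep -> J \in contract_indep -> #|I| < #|J| ->
  exists2 y, y \in J :\: I & y |: I \in contract_indep.
Proof.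
rewrite !inE => /andP[xI HI] /andP[xJ HJ] ltIJ.
have neq y : y \in J :\: I -> x \notin y |: I.
  rewrite !inE negb_or xI andbT => /andP[_ yJ].
  by apply: contraNneq xJ => ->.
case: ifP HI HJ => hx HI HJ; last first.
  have [y yJI yI] := indep_augment HI HJ ltIJ.
  by exists y; rewrite // inE neq // hx.
have ltx : #|x |: I| < #|x |: J| by rewrite !cardsU1 xI xJ ltn_add2l.
have [y] := indep_augment HI HJ ltx.
rewrite in_setD !in_setU1 negb_or => /andP[/andP[/negPf-> yI] /= yJ] yxI.
have yJI : y \in J :\: I by rewrite inE yI.
by exists y; rewrite // inE neq // hx setUCA.
Qed.

Definition contract : matroid T :=
  Matroid contract_indep_ground contract_indep_set0
          contract_indep_hereditary contract_indep_augment.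

End Contraction.

(* The choice k |-> x_k is a function on the subtype K (not on all of J), so
   that the empty set qualifies even when T is empty. *)
Definition partial_transversal (T J : finType) (A : J -> {set T})
    (X : {set T}) : Prop :=
  exists (K : {set J}) (f : {k : J | k \in K} -> T),
    [/\ injective f, forall k, f k \in A (val k) & X = f @: setT].

(* M = M[A] *)
Definition presentation (T J : finType) (A : J -> {set T})
    (M : matroid T) : Prop :=
  (forall j, A j \subset ground M) /\
  (forall X : {set T}, X \in indep M <-> partial_transversal A X).

(* s fixes everything outside E and has a single orbit on E; the identity is
   the cyclic permutation of an empty or one-element set. *)
Definition cyclic_perm (T : finType) (E : {set T}) (s : {perm T}) : Prop :=
  perm_on E s /\ (forall y z, y \in E -> z \in E -> z \in porbit s y).

Definition sigma_interval (T : finType) (E : {set T}) (s : {perm T})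
    (I : {set T}) : Prop :=
  exists (f : T) (n : nat),
    [/\ f \in E, n < #|E| & I = [set y in traject s f n.+1]].

(* Distinct indices carry incomparable sets, so no set is repeated. *)
Definition antichain (T J : finType) (A : J -> {set T}) : Prop :=
  forall j k, A j \subset A k -> j = k.

Definition multi_path (T : finType) (M : matroid T) : Prop :=
  exists (s : {perm T}) (J : finType) (A : J -> {set T}),
    [/\ cyclic_perm (ground M) s,
        forall j, sigma_interval (ground M) s (A j),
        antichain A
      & presentation A M].

(* Main.v *)
Require Import Defs.
From mathcomp Require Import all_boot all_fingroup zify.

(** If [x] is a loop, every interval avoids [x] and the same family presents
    [M/x] for the cycle with [x] removed.  Otherwise list the intervals through
    [x] as A_0, ..., A_(k-1) in the order of their first elements, and write
    A_i = L_i + {x} + R_i, with L_i before and R_i after [x].  The antichain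
    condition makes the L_i decrease and the R_i increase, and then
    L_i + R_(i+1) (i < k - 1), together with the intervals avoiding [x],
    presents [M/x]: in a matching into the new sets, left and right elements can
    be exchanged until all left ones have the smaller indices, which frees one
    A_m for [x].  The new sets are intervals with increasing first and last
    elements, so the antichain condition fails only through copies of the whole
    ground set, and these can each be shortened by their last element. *)

Set Implicit Arguments.
Unset Strict Implicit.
Unset Printing Implicit Defensive.

(** * Partial transversals as matchings into sets indexed by natural numbers *)

(** The matching goes from elements to indices and matters only on [X]; numeric indices turn shifts
    and exchanges into arithmetic. *)
Definition matchable (T : finType) (B : nat -> {set T}) (r : nat)
    (X : {set T}) : Prop :=
  exists g : T -> nat, {in X &, injective g} /\
    (forall y, y \in X -> g y < r /\ y \in B (g y)).

Lemma partial_transversalE (T J : finType) (A : J -> {set T})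
    (B : nat -> {set T}) (r : nat) (h : J -> nat) (X : {set T}) :
  injective h -> (forall j, h j < r) ->
  (forall i, i < r -> exists j, h j = i) -> (forall j, A j = B (h j)) ->
  partial_transversal A X <-> matchable B r X.
Proof.
move=> hI hr hS hA; split.
- case=> K [f [fI fA ->]].
  pose g y := if [pick k | f k == y] is Some k then h (val k) else 0.
  have gf k : g (f k) = h (val k).
    rewrite /g; case: pickP => [k' /eqP/fI-> //|/(_ k)].
    by rewrite eqxx.
  exists g; split=> [_ _ /imsetP[k _ ->] /imsetP[k' _ ->]|_ /imsetP[k _ ->]].
    by rewrite !gf => /hI/val_inj->.
  by rewrite gf hr -hA fA.
case=> g [gI gB].
pose K := [set j | [exists y, (y \in X) && (g y == h j)]].
have hK (k : {k : J | k \in K}) : exists y, (y \in X) && (g y == h (val k)).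
  by apply/existsP; have := valP k; rewrite inE.
pose f k := xchoose (hK k).
have fX k : f k \in X by have /andP[] := xchooseP (hK k).
have gf k : g (f k) = h (val k) by have /andP[_ /eqP] := xchooseP (hK k).
exists K, f; split.
- by move=> k k' eqf; apply/val_inj/hI; rewrite -!gf eqf.
- by move=> k; have [_] := gB _ (fX k); rewrite gf -hA.
apply/setP=> y; apply/idP/imsetP=> [yX|[k _ ->] //].
have [gr _] := gB _ yX; have [j hj] := hS _ gr.
have jK : j \in K by rewrite inE; apply/existsP; exists y; rewrite yX hj eqxx.
exists (exist _ j jK) => //; apply: gI => //.
by rewrite gf /= hj.
Qed.

Lemma partial_transversal_ordE (T : finType) (B : nat -> {set T}) (r : nat)
    (X : {set T}) :
  partial_transversal (fun i : 'I_r => B i) X <-> matchable B r X.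
Proof.
apply: (partial_transversalE (h := @nat_of_ord r)) => //.
- exact: ord_inj.
- by move=> i ir; exists (Ordinal ir).
Qed.

Lemma eq_matchable (T : finType) (B C : nat -> {set T}) (r : nat)
    (X : {set T}) :
  (forall i, i < r -> B i = C i) -> matchable B r X -> matchable C r X.
Proof.
move=> eqBC [g [gI gB]]; exists g; split=> // y yX.
by have [gr] := gB y yX; rewrite eqBC.
Qed.

Definition swapn (i j k : nat) : nat :=
  if k == i then j else if k == j then i else k.

Lemma swapn_inj i j : injective (swapn i j).
Proof. by move=> k l; rewrite /swapn; do !case: eqP; lia. Qed.

(** * Contraction as merging of consecutive sets *)

Section ContractMatching.

Variables (T : finType) (x : T) (B L R : nat -> {set T}) (r k : nat).
Hypotheses (k_gt0 : 0 < k) (k_le : k <= r).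
Hypothesis BE : forall i, i < k -> B i = x |: (L i :|: R i).
Hypothesis L_anti : forall i j, i <= j -> j < k -> L j \subset L i.
Hypothesis R_mono : forall i j, i <= j -> j < k -> R i \subset R j.
Hypothesis xB : forall i, k <= i -> i < r -> x \notin B i.

(** The [k] sets through [x] become [k.-1] merged ones; from index [k.-1] on, the sets avoiding [x]
    move down by one. *)
Definition merge_sets (i : nat) : {set T} :=
  if i.+1 < k then L i :|: R i.+1 else B i.+1.

(* A left element sitting above a right element can be exchanged with it, so
   the left elements may be moved to the smallest indices. *)
Lemma matchable_threshold (I : {set T}) :
  matchable merge_sets r.-1 I ->
  exists m (g : T -> nat), [/\ m < k, {in I &, injective g},
    forall y, y \in I -> g y < r.-1 /\ y \in merge_sets (g y),
    forall y, y \in I -> g y < m -> y \in L (g y)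
  & forall y, y \in I -> m <= g y -> (g y).+1 < k -> y \in R (g y).+1].
Proof.
case=> g0 [gI0 gC0].
(* Induction on the distance [d] from [m] to [k.-1], with the invariant that every element of index
   below [m] lies in its left set. *)
have H d : forall m g, m + d = k.-1 -> {in I &, injective g} ->
  (forall y, y \in I -> g y < r.-1 /\ y \in merge_sets (g y)) ->
  (forall y, y \in I -> g y < m -> y \in L (g y)) ->
  exists m (g : T -> nat), [/\ m < k, {in I &, injective g},
    forall y, y \in I -> g y < r.-1 /\ y \in merge_sets (g y),
    forall y, y \in I -> g y < m -> y \in L (g y)
  & forall y, y \in I -> m <= g y -> (g y).+1 < k -> y \in R (g y).+1].
  elim: d => [|d IHd] m g md gI gC gL.
    by exists m, g; split=> //; [lia | move=> y yI mg gk; exfalso; lia].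
  have [/existsP[y /and4P[yI mg gk yL]]|/existsPn noL] :=
      boolP [exists y, [&& y \in I, m <= g y, (g y).+1 < k & y \in L (g y)]];
    last first.
    exists m, g; split=> //; first lia.
    move=> y yI mg gk; have [_] := gC _ yI; rewrite /merge_sets gk inE.
    by have := noL y; rewrite yI mg gk /= => /negPf->.
  have [/existsP[z /and3P[zI /eqP gz zL]]|/existsPn noL] :=
      boolP [exists z, [&& z \in I, g z == m & z \in L m]].
    apply: (IHd m.+1 g) => //; first lia.
    move=> u uI; rewrite ltnS leq_eqVlt => /orP[/eqP gu|]; last exact: gL.
    by have -> : u = z by [apply: gI; rewrite // gu gz]; rewrite gz.
  (* Exchange [m] and [g y]: [y] moves down since the [L] decrease, and an element at [m],
     necessarily a right one, moves up since the [R] increase. *)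
  apply: (IHd m.+1 (fun u => swapn m (g y) (g u))) => //; first lia.
  - by move=> u v uI vI /swapn_inj; apply: gI.
  - move=> u uI; have [gr gCu] := gC _ uI; rewrite /swapn.
    case: eqP => [gu|_].
      split; first lia.
      have := noL u; rewrite uI gu eqxx /= => uL.
      move: gCu; rewrite /merge_sets gu gk.
      have -> : m.+1 < k by lia.
      rewrite !inE (negPf uL) /= => uR.
      by rewrite (subsetP (R_mono _ _) _ uR) ?orbT //; lia.
    case: eqP => // gu; split; first lia.
    have -> : u = y by apply: gI.
    rewrite /merge_sets; have -> : m.+1 < k by lia.
    by rewrite inE (subsetP (L_anti mg _) _ yL) //; lia.
  move=> u uI; have [gr gCu] := gC _ uI; rewrite /swapn.
  case: eqP => [gu gy|gum].
    by have -> : u = y by [apply: gI => //; lia]; apply: yL.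
  case: eqP => [gu _|gu glt]; last by apply: gL => //; lia.
  have -> : u = y by apply: gI.
  by apply: (subsetP (L_anti mg _) _ yL); lia.
by apply: (H k.-1 0 g0).
Qed.

(** From left to right, the index used by [x] is deleted: [L_anti] serves the elements above it,
    [R_mono] those below. Conversely, the threshold [m] of [matchable_threshold] is freed for [x]:
    smaller indices stay, the others move up by one. *)
Lemma matchable_contract (I : {set T}) :
  x \notin I -> matchable B r (x |: I) <-> matchable merge_sets r.-1 I.
Proof.
move=> xI.
have nx y : y \in I -> y == x = false.
  by move=> yI; apply/negbTE; apply: contraNneq xI => <-.
split.
- case=> g [gI gB].
  have [gxr gxB] := gB x (setU11 _ _).
  have gxk : g x < k.
    by rewrite ltnNge; apply/negP=> /xB/(_ gxr); rewrite gxB.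
  have gne y : y \in I -> g y != g x.
    move=> yI; apply/eqP=> /gI; rewrite !inE eqxx yI orbT => /(_ isT isT) yx.
    by move: (nx _ yI); rewrite yx eqxx.
  exists (fun y => unbump (g x) (g y)); split.
    move=> y z yI zI eqg; apply: gI; rewrite ?inE ?yI ?zI ?orbT //.
    move: (gne _ yI) (gne _ zI) eqg; rewrite /unbump.
    by do 2!case: ltngtP => //=; lia.
  move=> y yI; have [gr gBy] := gB y (setU1r _ yI).
  have gxy := gne _ yI; rewrite /unbump /merge_sets.
  case: (ltnP (g x) (g y)) => /= gyx.
    split; first lia.
    have -> : (g y - 1).+1 = g y by lia.
    case: ifP => // gk; move: gBy; rewrite BE // !inE nx //=.
    case/orP=> [yL|->]; rewrite ?orbT //.
    by rewrite (subsetP (L_anti _ _) _ yL) //; lia.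
  rewrite subn0; split; first lia.
  have -> : (g y).+1 < k by lia.
  move: gBy; rewrite BE; last by lia.
  rewrite !inE nx //= => /orP[->//|yR].
  by rewrite (subsetP (R_mono _ _) _ yR) ?orbT //; lia.
case/matchable_threshold=> m [g [mk gI gC gL gR]].
exists (fun y => if y == x then m else bump m (g y)); split.
  move=> y z; rewrite !inE.
  have [->|_] /= := eqVneq y x; have [->|_] //= := eqVneq z x; rewrite /bump.
  - by move=> _ _; case: leqP; lia.
  - by move=> _ _; case: leqP; lia.
  by move=> yI zI eqg; apply: gI => //; move: eqg; do 2!case: leqP; lia.
move=> y; rewrite !inE; have [->|_ /= yI] := eqVneq y x.
  by move=> _; rewrite BE // setU11; split=> //; lia.
have [gr gCy] := gC _ yI; rewrite /bump; case: (leqP m (g y)) => mg /=.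
  rewrite add1n; split; first lia.
  have [gk|gk] := ltnP (g y).+1 k.
    by rewrite BE // !inE gR ?orbT.
  by move: gCy; rewrite /merge_sets ltnNge gk.
rewrite add0n; split; first lia.
rewrite BE; last by lia.
by rewrite !inE gL ?orbT.
Qed.

End ContractMatching.

(** * Trimming sets without changing what is matchable *)

(* Removing from a full set [F i] a single element [e] that lies in another
   set [F l] is harmless: whatever is matched to [l] can be matched to [i]. *)
Lemma matchable_shrink1 (T : finType) (F F' : nat -> {set T}) (r i l : nat)
    (e : T) (X : {set T}) :
  i < r -> l < r -> l != i -> e \in F' l ->
  (forall j, j != i -> F' j = F j) -> X \subset F i -> F' i = F i :\ e ->
  matchable F r X -> matchable F' r X.
Proof.
move=> ir lr li eF' F'F XF F'i [g [gI gF]].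
have [/andP[eX /eqP ge]|ne] := boolP ((e \in X) && (g e == i)); last first.
  exists g; split=> // y yX; have [gr gFy] := gF _ yX; split=> //.
  have [gi|gi] := eqVneq (g y) i; last by rewrite F'F.
  move: gFy; rewrite gi F'i !inE => ->; rewrite andbT.
  by apply: contraNneq ne => <-; rewrite yX gi eqxx.
exists (fun y => swapn i l (g y)); split.
  by move=> y z yX zX /swapn_inj; apply: gI.
move=> y yX; have [gr gFy] := gF _ yX; rewrite /swapn.
case: eqP => [gi|/eqP gi].
  by have -> : y = e by [apply: gI; rewrite // gi ge]; split.
case: eqP => [gl|_]; last by rewrite F'F.
split=> //; rewrite F'i !inE (subsetP XF) // andbT.
by apply: contraNneq gi => ->; rewrite ge.
Qed.

(** The sets are trimmed one at a time. Each lost [e] stays in all other sets, since these lie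
    between [D l] and [C l] throughout, so [matchable_shrink1] applies at every stage. *)
Lemma matchable_shrink (T : finType) (C D : nat -> {set T}) (r : nat)
    (X : {set T}) :
  1 < r ->
  (forall i, i < r -> D i = C i \/ exists e,
     [/\ X \subset C i, D i = C i :\ e &
         forall l, l < r -> l != i -> e \in D l]) ->
  matchable C r X <-> matchable D r X.
Proof.
move=> r_gt1 CD.
have DC i : i < r -> D i \subset C i.
  by case/CD=> [->//|[e [_ -> _]]]; apply: subD1set.
split; last first.
  case=> g [gI gD]; exists g; split=> // y yX.
  by have [gr gDy] := gD _ yX; split=> //; apply: subsetP (DC _ gr) _ gDy.
move=> mC.
suff H m : m <= r -> matchable (fun i => if i < m then D i else C i) r X.
  by apply: eq_matchable (H r (leqnn r)) => i ->.
elim: m => [_|m IHm mr]; first exact: eq_matchable mC.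
have mF := IHm (ltnW mr).
have [DCm|[e [XC De eD]]] := CD _ mr.
  apply: eq_matchable mF => i _; rewrite ltnS (leq_eqVlt i m).
  by case: eqVneq => //= ->; rewrite ltnn DCm.
pose l := if m == 0 then 1 else 0.
have lr : l < r by rewrite /l; case: (m == 0); lia.
have lm : l != m by rewrite /l; case: (eqVneq m 0) => [->|]; lia.
apply: (matchable_shrink1 (i := m) (l := l) (e := e)) mF => //.
- by case: ifP => _; [|apply: (subsetP (DC _ lr))]; apply: eD.
- by move=> j jm; rewrite ltnS (leq_eqVlt j m) (negPf jm).
- by rewrite ltnn.
by rewrite ltnn leqnn.
Qed.

(** * Cyclic permutations as cyclic sequences *)

Lemma fcycle_iter_nth (T : eqType) (f : T -> T) (q : seq T) (x0 : T)
    (c i : nat) :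
  fcycle f q -> c < size q ->
  iter i f (nth x0 q c) = nth x0 q ((c + i) %% size q).
Proof.
move=> fq cq; elim: i => [|i IHi] /=; first by rewrite addn0 modn_small.
rewrite IHi addnS; have := ltn_pmod (c + i) (leq_ltn_trans (leq0n c) cq).
have -> : (c + i).+1 %% size q = ((c + i) %% size q).+1 %% size q.
  by rewrite -addn1 -modnDml addn1.
move: ((c + i) %% size q) => d dq.
have fE := fq; case: q fE dq {cq fq IHi} => // y q /= /(pathP x0).
rewrite size_rcons => fq; rewrite ltnS leq_eqVlt => /orP[/eqP dq|dq].
  have := fq d; rewrite dq ltnSn => /(_ isT) /eqP.
  rewrite modnn /= nth_rcons ltnn eqxx => {2}<-; congr (f _).
  by rewrite -rcons_cons nth_rcons /= ltnSn.
rewrite modn_small //=; have := fq d (ltnW dq) => /eqP.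
rewrite nth_rcons dq => <-; congr (f _).
by rewrite -rcons_cons nth_rcons /= ltnS ltnW.
Qed.

(** As [m < size q], the trajectory goes round at most once; the second disjunct covers the
    positions reached after wrapping past the end of [q]. *)
Lemma mem_traject_fcycle (T : eqType) (f : T -> T) (q : seq T) (x0 y : T)
    (c m : nat) :
  uniq q -> fcycle f q -> c < size q -> m < size q -> y \in q ->
  (y \in traject f (nth x0 q c) m.+1) =
  (c <= index y q <= c + m) || (index y q + size q <= c + m).
Proof.
move=> uq fq cq mq yq; have dq : index y q < size q by rewrite index_mem.
rewrite -{1}(nth_index x0 yq); move: (index y q) dq => d dq.
apply/trajectP/idP => [[i im]|].
  rewrite (fcycle_iter_nth x0 i fq cq) => /eqP.
  rewrite nth_uniq //; last by rewrite ltn_pmod //; lia.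
  move=> /eqP->; have [ci|ci] := ltnP (c + i) (size q).
    by rewrite modn_small //; lia.
  by rewrite -(subnK ci) modnDr modn_small //; lia.
case/orP=> H.
  exists (d - c); first lia.
  by rewrite (fcycle_iter_nth x0 _ fq cq) subnKC ?modn_small //; lia.
exists (d + size q - c); first lia.
rewrite (fcycle_iter_nth x0 _ fq cq) subnKC; last by lia.
by rewrite modnDr modn_small.
Qed.

Lemma cyclic_perm_fcycle (T : finType) (E : {set T}) (s : {perm T}) (x : T) :
  cyclic_perm E s -> x \in E ->
  exists q, [/\ uniq (x :: q), fcycle s (x :: q) & x :: q =i E].
Proof.
case=> sE sO xE.
have xq : fingraph.orbit s x = x :: behead (fingraph.orbit s x).
  by rewrite /fingraph.orbit -orderSpred.
exists (behead (fingraph.orbit s x)); rewrite -xq; split.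
- exact: orbit_uniq.
- exact/cycle_orbit/perm_inj.
move=> y; rewrite -fconnect_orbit; apply/idP/idP => [/connectP[p]|yE].
  elim: p x xE {sO xq} => [|z p IHp] x xE /=; first by move=> _ ->.
  case/andP=> /eqP <- ps yl; apply: (IHp (s x)) => //.
  by rewrite (perm_closed x sE).
have /porbitP[i ->] := sO _ _ xE yE.
by rewrite permX fconnect_iter.
Qed.

Lemma fcycle_cyclic_perm (T : finType) (E : {set T}) (s : {perm T})
    (q : seq T) :
  fcycle s q -> q =i E -> (forall y, y \notin E -> s y = y) ->
  cyclic_perm E s.
Proof.
move=> sq qE sE; split.
  by apply/subsetP=> y; rewrite inE; apply: contraR => /sE->.
move=> y z; rewrite -!qE => yq zq.
have cq : index y q < size q by rewrite index_mem.
have dq : index z q < size q by rewrite index_mem.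
(* Adding [size q] keeps the subtraction from truncating and vanishes modulo the cycle length. *)
suff -> : z = (s ^+ (index z q + size q - index y q))%g y by apply: mem_porbit.
rewrite permX -{2}(nth_index y yq) (fcycle_iter_nth y _ sq cq) subnKC; last lia.
by rewrite modnDr modn_small // nth_index.
Qed.

(** * Intervals by positions on the cycle cut at [x] *)

Section Positions.

Variables (T : finType) (E : {set T}) (x : T) (q : seq T).
Hypothesis qE : x :: q =i E.

(* Positions start at [pos x = 0]; [wseg a b] is the interval running from
   position [a] through [x] to position [b], without [x] itself. *)
Definition pos (y : T) : nat := index y (x :: q).
Definition seg (a b : nat) : {set T} := [set y in E | a <= pos y <= b].
Definition wseg (a b : nat) : {set T} := seg a (size q) :|: seg 1 b.

Definition elt (d : nat) : T := nth x (x :: q) d.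

Lemma elt_ground d : d <= size q -> elt d \in E.
Proof. by move=> dq; rewrite -qE mem_nth. Qed.

Lemma elt_pos y : y \in E -> elt (pos y) = y.
Proof. by rewrite -qE => yq; apply: nth_index. Qed.

Lemma pos_le y : y \in E -> pos y <= size q.
Proof. by rewrite -qE -index_mem. Qed.

Lemma pos_eq0 y : (pos y == 0) = (y == x).
Proof. by rewrite /pos /= (eq_sym x); case: (y == x). Qed.

Lemma mem_seg a b y : (y \in seg a b) = (y \in E) && (a <= pos y <= b).
Proof. by rewrite inE. Qed.

Lemma mem_wseg a b y :
  0 < a -> (y \in wseg a b) = (y \in E :\ x) && ((a <= pos y) || (pos y <= b)).
Proof.
move=> a0; rewrite 2!inE !mem_seg !inE -pos_eq0.
by case: (boolP (y \in E)) => [/pos_le|_]; rewrite ?andbF //=; lia.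
Qed.

Lemma seg_subset a b : 0 < a -> seg a b \subset E :\ x.
Proof.
by move=> a0; apply/subsetP=> y; rewrite mem_seg !inE -pos_eq0 => /andP[->]; lia.
Qed.

Lemma wseg_subset a b : 0 < a -> wseg a b \subset E :\ x.
Proof. by move=> a0; apply/subsetP=> y; rewrite mem_wseg // => /andP[]. Qed.

Hypothesis uq : uniq (x :: q).

Lemma pos_elt d : d <= size q -> pos (elt d) = d.
Proof. by move=> dq; rewrite /pos index_uniq. Qed.

Lemma elt_neq d : 0 < d -> d <= size q -> elt d != x.
Proof. by move=> d0 dq; rewrite -pos_eq0 pos_elt // -lt0n. Qed.

Lemma card_cycle : #|E| = (size q).+1.
Proof. by rewrite -(eq_card qE) (card_uniqP uq). Qed.

End Positions.

(** * The cycle with [x] removed and its intervals *)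

Section CycleContraction.

Variables (T : finType) (E : {set T}) (s : {perm T}) (x : T) (q : seq T).
Hypotheses (uq : uniq (x :: q)) (sq : fcycle s (x :: q)) (qE : x :: q =i E).

(** The factor [s] acts first: the predecessor of [x] now goes to [s x], [x] becomes fixed, and
    other images are unchanged. *)
Definition contract_perm : {perm T} := (s * tperm x (s x))%g.

Lemma fcycle_contract_perm : fcycle contract_perm q.
Proof.
have H y u p : x \notin p -> y \notin p -> fpath s u (rcons p x) ->
    fpath (s * tperm x y)%g u (rcons p y).
  elim: p u => [|v p IHp] u /=.
    by rewrite !andbT permM => _ _ /eqP->; rewrite tpermL.
  rewrite !inE !negb_or => /andP[xv xp] /andP[yv yp] /andP[/eqP su pu].
  by rewrite permM su tpermD ?eqxx ?IHp.
move: uq sq; rewrite /contract_perm; case: q => //= y p.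
rewrite !inE negb_or => /andP[/andP[_ xp] /andP[yp _]] /andP[/eqP sx].
by rewrite sx; apply: H.
Qed.

Lemma mem_contract_cycle : q =i E :\ x.
Proof.
move=> y; rewrite !inE -qE inE; move: uq => /= /andP[xq _].
by case: eqVneq => //= ->; apply/negbTE.
Qed.

Lemma cyclic_perm_contract :
  (forall y, y \notin E -> s y = y) -> cyclic_perm (E :\ x) contract_perm.
Proof.
move=> sE; apply: fcycle_cyclic_perm fcycle_contract_perm mem_contract_cycle _.
move=> y; rewrite !inE negb_and negbK permM.
case: eqVneq => [-> _|yx /= yE]; first by rewrite tpermR.
have sxy : s x != y.
  by apply: contraNneq yx => sxy; apply/eqP/(@perm_inj _ s); rewrite sE.
by rewrite (sE y) // tpermD // eq_sym.
Qed.

Local Notation pos := (pos x q).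
Local Notation elt := (elt x q).
Local Notation seg := (seg E x q).
Local Notation wseg := (wseg E x q).

(** An interval starting at [x] has an empty left part, coded by [ab.1 = (size q).+1]; one ending at
    [x] has [ab.2 = 0]. The bound [ab.2 < ab.1] says that the interval does not overlap itself. *)
Lemma sigma_interval_pos (I : {set T}) :
  sigma_interval E s I -> exists ab : nat * nat,
    if x \in I then
      [/\ 0 < ab.1, ab.1 <= (size q).+1, ab.2 < ab.1 & I = x |: wseg ab.1 ab.2]
    else [/\ 0 < ab.1, ab.1 <= ab.2, ab.2 <= size q & I = seg ab.1 ab.2].
Proof.
case=> f [m [fE]]; rewrite (card_cycle qE uq) => mq ->.
have cq := pos_le qE fE; rewrite -{1 2 3}(elt_pos qE fE).
move: (pos f) cq => c cq {f fE}.
have mem y : y \in E ->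
  (y \in traject s (elt c) m.+1) =
  (c <= pos y <= c + m) || (pos y + (size q).+1 <= c + m).
  by move=> yE; rewrite (mem_traject_fcycle x (q := x :: q)) // qE.
have sub y : y \in traject s (elt c) m.+1 -> y \in E.
  case/trajectP=> i _ ->; rewrite (fcycle_iter_nth x i sq) //= -qE mem_nth //.
  by rewrite ltn_mod.
have pos0 : pos x = 0 by apply/eqP; rewrite pos_eq0.
have xE : x \in E by rewrite -qE mem_head.
rewrite in_set mem // pos0.
have [c0|c0] := posnP c.
  move: c0 cq mem sub => -> _ mem sub; exists ((size q).+1, m); split=> //=.
  apply/setP=> y; rewrite in_set in_setU1 (mem_wseg qE) // in_setD1 -(pos_eq0 x q).
  have [yE|yE] := boolP (y \in E).
    by rewrite mem //; have := pos_le qE yE; lia.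
  rewrite andbF orbF (negPf (contraNN (@sub y) yE)).
  by apply/esym/negbTE; apply: contraNN yE; rewrite pos_eq0 => /eqP->.
have [cm|cm] := leqP (size q).+1 (c + m).
  rewrite orbT; exists (c, c + m - (size q).+1); split=> //=; try lia.
  apply/setP=> y; rewrite in_set in_setU1 (mem_wseg qE) // in_setD1 -(pos_eq0 x q).
  have [yE|yE] := boolP (y \in E).
    by rewrite mem //; have := pos_le qE yE; lia.
  rewrite andbF orbF (negPf (contraNN (@sub y) yE)).
  by apply/esym/negbTE; apply: contraNN yE; rewrite pos_eq0 => /eqP->.
rewrite orbF leqNgt c0 /=.
exists (c, c + m); split=> //=; try lia.
apply/setP=> y; rewrite in_set mem_seg.
have [yE|yE] := boolP (y \in E).
  by rewrite mem //; have := pos_le qE yE; lia.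
by rewrite (negPf (contraNN (@sub y) yE)).
Qed.

(** Dropping the head [x] lowers every position by one, so index [c] of [q] is position [c.+1];
    hence the strict bound and the [m.+1]. *)
Lemma sigma_interval_contract (c m : nat) (I : {set T}) :
  c < size q -> m < size q -> I \subset E :\ x ->
  (forall y, y \in E :\ x ->
     (y \in I) = (c < pos y <= c + m.+1) || (pos y + size q <= c + m.+1)) ->
  sigma_interval (E :\ x) contract_perm I.
Proof.
move=> cq mq sI memI.
have uq' : uniq q by case/andP: uq.
exists (nth x q c), m; split.
- by rewrite -mem_contract_cycle mem_nth.
- by rewrite -(eq_card mem_contract_cycle) (card_uniqP uq').
have posS y : y \in q -> pos y = (index y q).+1.
  by rewrite mem_contract_cycle !inE eq_sym /pos /= => /andP[/negPf->].
apply/setP=> y; rewrite in_set; have [yE|yE] := boolP (y \in E :\ x).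
  have yq : y \in q by rewrite mem_contract_cycle.
  rewrite memI // (mem_traject_fcycle x uq' fcycle_contract_perm cq mq yq).
  by rewrite posS // addnS addSn !ltnS.
rewrite (negPf (contraNN (subsetP sI y) yE)); apply/esym/negbTE.
apply: contraNN yE => /trajectP[i _ ->].
rewrite (fcycle_iter_nth x i fcycle_contract_perm cq) -mem_contract_cycle.
by rewrite mem_nth // ltn_mod (leq_ltn_trans _ cq).
Qed.

Lemma sigma_interval_seg a b :
  0 < a -> a <= b -> b <= size q ->
  sigma_interval (E :\ x) contract_perm (seg a b).
Proof.
move=> a0 ab bq.
apply: (@sigma_interval_contract a.-1 (b - a)); try lia; first exact: seg_subset.
move=> y; rewrite mem_seg !inE -(pos_eq0 x q) => /andP[y0 yE].
by rewrite yE /=; have := pos_le qE yE; lia.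
Qed.

Lemma sigma_interval_wseg a b :
  0 < a -> a <= size q -> b < a ->
  sigma_interval (E :\ x) contract_perm (wseg a b).
Proof.
move=> a0 aq ab.
apply: (@sigma_interval_contract a.-1 (size q + b - a)); try lia.
  by apply: (wseg_subset qE).
move=> y yE; rewrite (mem_wseg qE) // yE.
move: yE; rewrite !inE -(pos_eq0 x q) => /andP[y0 yE].
by have := pos_le qE yE; lia.
Qed.

End CycleContraction.

(** * Sorted families of intervals, merged and trimmed *)

(* The sets of an interval presentation sorted by first element, the [k] sets
   through [x] coming first: set [i < k] runs from position [a i] through [x]
   to position [b i], set [i >= k] from position [a i] to position [b i]. *)
Section SortedArcs.

Variables (T : finType) (E : {set T}) (x : T) (q : seq T).
Hypotheses (uq : uniq (x :: q)) (qE : x :: q =i E).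
Variables (r k : nat) (a b : nat -> nat).
Hypotheses (k_gt0 : 0 < k) (k_le : k <= r).
Hypothesis wsegP : forall i, i < k ->
  [/\ 0 < a i, a i <= (size q).+1 & b i < a i].
Hypothesis segP : forall i, k <= i -> i < r ->
  [/\ 0 < a i, a i <= b i & b i <= size q].
Hypothesis wseg_wseg : forall i j, i < j -> j < k -> a i < a j /\ b i < b j.
Hypothesis seg_seg : forall i j, k <= i -> i < j -> j < r ->
  a i < a j /\ b i < b j.
(** If either inequality failed, set [j] would lie inside set [i]. *)
Hypothesis wseg_seg : forall i j, i < k -> k <= j -> j < r ->
  a j < a i /\ b i < b j.
(** With [a i <= (b i).+1], set [i] would be all of [E] and contain any other set. *)
Hypothesis wseg_proper : forall i, 1 < r -> i < k -> (b i).+1 < a i.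

Local Notation seg := (seg E x q).
Local Notation wseg := (wseg E x q).
Local Notation pos := (pos x q).
Local Notation elt := (elt x q).

(** These are the [merge_sets] in coordinates; a merged interval may overlap itself and is then all
    of [E :\ x]. *)
Definition contract_sets (i : nat) : {set T} :=
  if i.+1 < k then wseg (a i) (b i.+1) else seg (a i.+1) (b i.+1).

(* [E :\ x] may occur several times among the merged sets; each copy loses the
   last element of the corresponding seg. *)
Definition trimmed_sets (i : nat) : {set T} :=
  if i.+1 < k then wseg (a i) (minn (b i.+1) (a i - 2))
  else seg (a i.+1) (minn (b i.+1) (size q + a i.+1 - 2)).

Lemma wseg_le i : i.+1 < k -> a i <= size q.
Proof. by move=> ik; have [] := wseg_wseg (ltnSn i) ik; have [] := wsegP ik; lia. Qed.

Lemma mem_trimmed i y : i < r.-1 -> y \in E -> y != x ->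
  (y \in trimmed_sets i) =
  if i.+1 < k then (a i <= pos y) || (pos y <= minn (b i.+1) (a i - 2))
  else (a i.+1 <= pos y <= minn (b i.+1) (size q + a i.+1 - 2)).
Proof.
move=> ir yE yx; rewrite /trimmed_sets; case: ifP => ik.
  by rewrite (mem_wseg qE) // ?inE ?yx ?yE //; have [] := wsegP (ltnW ik).
by rewrite mem_seg yE.
Qed.

(** For distinct [i] and [j], each case finds, from the strict order of the endpoints, a position in
    set [i] but not in set [j]. *)
Lemma trimmed_antichain i j : 2 < r -> i < r.-1 -> j < r.-1 ->
  trimmed_sets i \subset trimmed_sets j -> i = j.
Proof.
move=> r_gt2 ir jr /subsetP sub.
have {}sub d : 0 < d -> d <= size q ->
  (if i.+1 < k then (a i <= d) || (d <= minn (b i.+1) (a i - 2))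
   else (a i.+1 <= d <= minn (b i.+1) (size q + a i.+1 - 2))) ->
  (if j.+1 < k then (a j <= d) || (d <= minn (b j.+1) (a j - 2))
   else (a j.+1 <= d <= minn (b j.+1) (size q + a j.+1 - 2))).
  move=> d0 dq; have := sub (elt d).
  by rewrite !mem_trimmed ?elt_neq ?(elt_ground qE) // pos_elt.
have [//|ij] := eqVneq i j; exfalso.
have [ik|ik] := ltnP i.+1 k; have [jk|jk] := ltnP j.+1 k.
- have [a_j _ _] := wsegP (ltnW jk); have aj := wseg_le jk.
  have pj := wseg_proper (ltnW r_gt2) (ltnW jk).
  have [lt_ij|lt_ji] : i < j \/ j < i by lia.
    have [aij _] := wseg_wseg lt_ij (ltnW jk).
    (* Trimming keeps position [(a j).-1] out of set [j], while the left part of set [i] has begun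
       by then. *)
    by move: (sub (a j).-1); rewrite ik jk; lia.
  have [aij _] := wseg_wseg lt_ji (ltnW ik).
  have [_ bij] := @wseg_wseg j.+1 i.+1 lt_ji ik.
  by move: (sub (minn (b j.+1) (a j - 2)).+1); rewrite ik jk; lia.
- have ai := wseg_le ik; have [a_j abj bj] := @segP j.+1 jk ltac:(lia).
  have [aji _] := @wseg_seg i j.+1 (ltnW ik) jk ltac:(lia).
  have [_ bij] := @wseg_seg i.+1 j.+1 ik jk ltac:(lia).
  have [_ bii] := wseg_wseg (ltnSn i) ik.
  (* After trimming, a [seg] that starts at position 1 misses [size q]; any other misses position
     1. *)
  have [aj1|aj1] := leqP (a j.+1) 1.
    by move: (sub (size q)); rewrite ik [j.+1 < k]ltnNge jk /=; lia.
  by move: (sub 1); rewrite ik [j.+1 < k]ltnNge jk /=; lia.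
- have aj := wseg_le jk; have [a_i abi bi] := @segP i.+1 ik ltac:(lia).
  have pj := wseg_proper (ltnW r_gt2) (ltnW jk).
  have [aij _] := @wseg_seg j i.+1 (ltnW jk) ik ltac:(lia).
  have [_ bij] := @wseg_seg j.+1 i.+1 jk ik ltac:(lia).
  (* A position of the [seg] inside the gap of the trimmed [wseg]. *)
  move: (sub (maxn (a i.+1) (minn (b j.+1) (a j - 2)).+1)).
  by rewrite jk [i.+1 < k]ltnNge ik /=; lia.
have [a_i abi bi] := @segP i.+1 ik ltac:(lia).
have [a_j abj bj] := @segP j.+1 jk ltac:(lia).
have [lt_ij|lt_ji] : i < j \/ j < i by lia.
  have [aij bij] := @seg_seg i.+1 j.+1 ik lt_ij ltac:(lia).
  by move: (sub (a i.+1)); rewrite [i.+1 < k]ltnNge ik [j.+1 < k]ltnNge jk /=; lia.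
have [aij bij] := @seg_seg j.+1 i.+1 jk lt_ji ltac:(lia).
by move: (sub (b i.+1)); rewrite [i.+1 < k]ltnNge ik [j.+1 < k]ltnNge jk /=; lia.
Qed.

Definition sorted_sets (i : nat) : {set T} :=
  if i < k then x |: wseg (a i) (b i) else seg (a i) (b i).

Lemma matchable_sorted_contract (I : {set T}) : x \notin I ->
  matchable sorted_sets r (x |: I) <-> matchable contract_sets r.-1 I.
Proof.
move=> xI.
rewrite (@matchable_contract _ x sorted_sets
  (fun i => seg (a i) (size q)) (fun i => seg 1 (b i)) r k) //.
- split; apply: eq_matchable => i ir; rewrite /merge_sets /contract_sets;
    by case: ifP => // ik; rewrite /sorted_sets ik.
- by move=> i ik; rewrite /sorted_sets ik.
- move=> i j; rewrite leq_eqVlt => /orP[/eqP-> //|ij jk].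
  have [aij _] := wseg_wseg ij jk.
  by apply/subsetP=> y; rewrite !mem_seg => /andP[->]; lia.
- move=> i j; rewrite leq_eqVlt => /orP[/eqP-> //|ij jk].
  have [_ bij] := wseg_wseg ij jk.
  by apply/subsetP=> y; rewrite !mem_seg => /andP[->]; lia.
move=> i ik ir; rewrite /sorted_sets ltnNge ik /=.
have [a_i _ _] := segP ik ir.
by apply/negP=> /(subsetP (seg_subset E x q (b i) a_i)); rewrite !inE eqxx.
Qed.

(** Only copies of [E :\ x] are cut, and the element each one loses lies in every other trimmed set;
    [2 < r] leaves at least two sets for the exchange. *)
Lemma matchable_trimmed (I : {set T}) : 2 < r -> I \subset E :\ x ->
  matchable contract_sets r.-1 I <-> matchable trimmed_sets r.-1 I.
Proof.
move=> r_gt2 /subsetP IE; apply: matchable_shrink => [|i ir]; first lia.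
have [ik|ik] := ltnP i.+1 k.
  have [a_i _ _] := wsegP (ltnW ik); have ai := wseg_le ik.
  have pi := wseg_proper (ltnW r_gt2) (ltnW ik).
  have [le_ba|lt_ab] := leqP (b i.+1) (a i - 2).
    by left; rewrite /trimmed_sets /contract_sets ik (minn_idPl le_ba).
  (* Here [b i.+1] is at least [(a i).-1], so the merged set is full, and the cap [a i - 2] removes
     exactly position [(a i).-1]. *)
  right; exists (elt (a i).-1).
  have e0 : 0 < (a i).-1 by lia.
  have eq : (a i).-1 <= size q by lia.
  split.
  - apply/subsetP=> y /IE yE; rewrite /contract_sets ik (mem_wseg qE) // yE /=.
    by lia.
  - apply/setP=> y; rewrite in_setD1 /trimmed_sets /contract_sets ik.
    rewrite !(mem_wseg qE) //; have [yE|] := boolP (y \in E :\ x); last first.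
      by rewrite andbF.
    have yE' : y \in E by move: yE; rewrite inE => /andP[].
    have -> : (y != elt (a i).-1) = (pos y != (a i).-1).
      congr (~~ _); apply/eqP/eqP=> [->|<-]; first by rewrite (pos_elt uq).
      by rewrite (elt_pos qE).
    by rewrite /=; lia.
  move=> l lr li; rewrite mem_trimmed ?(elt_ground qE) ?(elt_neq uq) //.
  rewrite (pos_elt uq) //; case: ifP => lk.
    have [lt_il|lt_li] : i < l \/ l < i by lia.
      have [ail _] := wseg_wseg lt_il (ltnW lk).
      by have [_ bil] := @wseg_wseg i.+1 l.+1 lt_il lk; lia.
    by have [ali _] := wseg_wseg lt_li (ltnW ik); lia.
  have {}lk : k <= l.+1 by lia.
  have [a_l abl bl] := @segP l.+1 lk ltac:(lia).
  have [ali _] := @wseg_seg i l.+1 (ltnW ik) lk ltac:(lia).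
  by have [_ bil] := @wseg_seg i.+1 l.+1 ik lk ltac:(lia); lia.
have [a_i abi bi] := @segP i.+1 ik ltac:(lia).
have nik : (i.+1 < k) = false by lia.
(* This cap bites only when [a i.+1 = 1] and [b i.+1 = size q], that is, on a full set. *)
have [le_ba|lt_ab] := leqP (b i.+1) (size q + a i.+1 - 2).
  by left; rewrite /trimmed_sets /contract_sets nik (minn_idPl le_ba).
right; exists (elt (size q)).
have a1 : a i.+1 = 1 by lia.
have bq : b i.+1 = size q by lia.
have q0 : 0 < size q by lia.
split.
- apply/subsetP=> y /IE; rewrite /contract_sets nik mem_seg !inE.
  rewrite -(pos_eq0 x q) => /andP[y0 yE]; rewrite yE /=.
  by have := pos_le qE yE; lia.
- apply/setP=> y; rewrite in_setD1 /trimmed_sets /contract_sets nik.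
  rewrite !mem_seg; have [yE|] := boolP (y \in E); last by rewrite andbF.
  have -> : (y != elt (size q)) = (pos y != size q).
    congr (~~ _); apply/eqP/eqP=> [->|<-]; first by rewrite (pos_elt uq).
    by rewrite (elt_pos qE).
  by have := pos_le qE yE; rewrite /=; lia.
move=> l lr li; rewrite mem_trimmed ?(elt_ground qE) ?(elt_neq uq) //.
rewrite (pos_elt uq) //; case: ifP => lk.
  by have := wseg_le lk; lia.
have {}lk : k <= l.+1 by lia.
have [a_l abl bl] := @segP l.+1 lk ltac:(lia).
have [lt_il|lt_li] : i < l \/ l < i by lia.
  by have [ail bil] := @seg_seg i.+1 l.+1 ik lt_il ltac:(lia); lia.
by have [ail bil] := @seg_seg l.+1 i.+1 lk lt_li ltac:(lia); lia.
Qed.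

(** For [r <= 2] at most one set remains, so the antichain condition is trivial and the merged sets
    serve untrimmed; otherwise the trimmed ones are used. *)
Lemma sorted_contract_interval_family (s : {perm T}) : fcycle s (x :: q) ->
  exists F : 'I_r.-1 -> {set T},
  [/\ forall i, sigma_interval (E :\ x) (contract_perm s x) (F i), antichain F
   & forall I : {set T}, I \subset E :\ x ->
       matchable sorted_sets r (x |: I) <-> partial_transversal F I].
Proof.
move=> sq.
have xI (I : {set T}) : I \subset E :\ x -> x \notin I.
  by rewrite subsetD1 => /andP[].
have [r_le2|r_gt2] := leqP r 2.
  exists (fun i => contract_sets i); split.
  - move=> [i /= ir]; rewrite /contract_sets; case: ltnP => ik.
      have [a_i _ _] := wsegP (ltnW ik).
      (* Capping at [(a i).-1] changes no element but stops the interval from overlapping itself. *)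
      have -> : wseg (a i) (b i.+1) = wseg (a i) (minn (b i.+1) (a i).-1).
        by apply/setP=> y; rewrite !(mem_wseg qE) //; congr (_ && _); lia.
      by apply: (sigma_interval_wseg uq sq qE) => //; [exact: wseg_le | lia].
    have [a_i abi bi] := @segP i.+1 ik ltac:(lia).
    exact: (sigma_interval_seg uq sq qE).
  - by move=> [i ir] [j jr] _; apply/val_inj => /=; lia.
  by move=> I /xI xI'; rewrite partial_transversal_ordE matchable_sorted_contract.
exists (fun i => trimmed_sets i); split.
- move=> [i /= ir]; rewrite /trimmed_sets; case: ltnP => ik.
    have [a_i _ _] := wsegP (ltnW ik).
    apply: (sigma_interval_wseg uq sq qE) => //; first exact: wseg_le.
    by have := wseg_proper (ltnW r_gt2) (ltnW ik); lia.
  have [a_i abi bi] := @segP i.+1 ik ltac:(lia).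
  apply: (sigma_interval_seg uq sq qE) => //; last by lia.
  (* A trimmed [seg] is nonempty because [1 < size q], which follows from a second set through [x]
     or, failing that, from two distinct [seg] sets. *)
  have [ik2|ik2] := ltnP 1 k.
    by have := wseg_le ik2; have := wseg_proper (ltnW r_gt2) (ltnW ik2); lia.
  have [|||a12 b12] := @seg_seg 1 2; try lia.
  have [a1 _ _] := @segP 1 ltac:(lia) ltac:(lia).
  by have [_ a2 b2] := @segP 2 ltac:(lia) ltac:(lia); lia.
- by move=> [i ir] [j jr] /(trimmed_antichain r_gt2 ir jr) ij; apply/val_inj.
move=> I IE; rewrite partial_transversal_ordE -matchable_trimmed //.
by apply: matchable_sorted_contract; apply: xI.
Qed.

End SortedArcs.

(** * Sorting an antichain of intervals *)

Lemma contract_interval_family (T : finType) (E : {set T}) (s : {perm T})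
    (x : T) (q : seq T) (J : finType) (A : J -> {set T}) (j0 : J) :
  uniq (x :: q) -> fcycle s (x :: q) -> x :: q =i E ->
  (forall j, sigma_interval E s (A j)) -> antichain A -> x \in A j0 ->
  exists r (F : 'I_r -> {set T}),
  [/\ forall i, sigma_interval (E :\ x) (contract_perm s x) (F i), antichain F
    & forall I : {set T}, I \subset E :\ x ->
        partial_transversal A (x |: I) <-> partial_transversal F I].
Proof.
move=> uq sq qE sA acA xj0.
have [ab abP] := fin_all_exists (fun j => sigma_interval_pos uq sq qE (sA j)).
pose a j := (ab j).1; pose b j := (ab j).2.
have wA j : x \in A j -> [/\ 0 < a j, a j <= (size q).+1, b j < a j &
    A j = x |: wseg E x q (a j) (b j)].
  by move=> xA; have := abP j; rewrite xA.
have nA j : x \notin A j -> [/\ 0 < a j, a j <= b j, b j <= size q &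
    A j = seg E x q (a j) (b j)].
  by move=> /negPf xA; have := abP j; rewrite xA.
(* In this and the next two comparisons, nested endpoints would give nested sets, against the
   antichain condition. *)
have cmpW j l : x \in A j -> x \in A l -> a j <= a l -> b l <= b j -> l = j.
  move=> xj xl aa bb; apply: acA.
  have [aj _ _ ->] := wA _ xj; have [al _ _ ->] := wA _ xl.
  apply/setUS/subsetP=> y; rewrite !(mem_wseg qE) // => /andP[-> /=]; lia.
have cmpN j l : x \notin A j -> x \notin A l -> a j <= a l -> b l <= b j ->
    l = j.
  move=> xj xl aa bb; apply: acA.
  have [_ _ _ ->] := nA _ xj; have [_ _ _ ->] := nA _ xl.
  by apply/subsetP=> y; rewrite !mem_seg => /andP[-> /=]; lia.
have cmpNW j l : x \in A j -> x \notin A l -> a l < a j /\ b j < b l.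
  move=> xj xl; have [aj _ _ Aj] := wA _ xj; have [al abl bl Al] := nA _ xl.
  suff : ~~ ((a j <= a l) || (b l <= b j)) by lia.
  apply/negP=> H; suff lj : l = j by move: xl; rewrite lj xj.
  apply: acA; rewrite Aj Al; apply/subsetU/orP; right.
  apply/subsetP=> y yA; have yE := subsetP (seg_subset E x q (b l) al) _ yA.
  by rewrite (mem_wseg qE) // yE /=; move: yA; rewrite mem_seg => /andP[_]; lia.
have properW j : 1 < #|J| -> x \in A j -> (b j).+1 < a j.
  move=> J1 xj; have [aj _ baj Aj] := wA _ xj.
  rewrite ltnNge; apply/negP=> aleb.
  (* Otherwise [A j] is all of [E] and contains every member, so [J] has a single index. *)
  suff lj l : l = j.
    move: J1; rewrite ltnNge => /negP[]; apply/fintype_le1P=> l l'.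
    by rewrite (lj l) (lj l').
  apply: acA; apply: (@subset_trans _ _ (mem E)).
    have [f [m [fE _ ->]]] := sA l; apply/subsetP=> y.
    rewrite inE => /trajectP[i _ ->]; move: fE; rewrite -qE => fq.
    rewrite -(nth_index x fq) (fcycle_iter_nth x i sq) ?index_mem // -qE.
    by rewrite mem_nth // ltn_mod.
  apply/subsetP=> y yE; rewrite Aj in_setU1 (mem_wseg qE) // in_setD1 yE.
  by case: eqVneq => //= _; lia.
(* As [a j <= (size q).+1] for members through [x], this shift sorts the members avoiding [x] after
   them. *)
pose key j := if x \in A j then a j else a j + (size q).+1.
have keyI : injective key.
  move=> j l; rewrite /key; case: ifP => xj; case: ifP => xl eqk.
  - by case: (leqP (b j) (b l)) => bb; [|symmetry]; apply: cmpW; lia.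
  - by have [_ ? _ _] := wA _ xj; have [|? _ _ _] := nA l; lia.
  - by have [_ ? _ _] := wA _ xl; have [|? _ _ _] := nA j; lia.
  by case: (leqP (b j) (b l)) => bb; [|symmetry]; apply: cmpN; lia.
pose e := sort (relpre key leq) (enum J).
have ue : uniq e by rewrite sort_uniq enum_uniq.
have me j : j \in e by rewrite mem_sort mem_enum.
have se : size e = #|J| by rewrite size_sort cardE.
pose u i := nth j0 e i.
have key_lt i j : i < j -> j < size e -> key (u i) < key (u j).
  move=> ij jr; rewrite ltn_neqAle; apply/andP; split.
    apply/eqP=> /keyI/eqP; rewrite /u nth_uniq // ?(ltn_trans ij jr) //.
    by rewrite ltn_eqF.
  apply: (@sorted_ltn_nth _ (relpre key leq)) => //; rewrite ?inE ?(ltn_trans ij jr) //.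
  - by move=> ? ? ?; apply: leq_trans.
  - by apply: sort_sorted => ? ?; apply: leq_total.
pose k := find (fun j => x \notin A j) e.
have uW i : i < k -> x \in A (u i) by move/(before_find j0)/negbFE.
have uN i : k <= i -> i < size e -> x \notin A (u i).
  move=> ki ir; have kr := leq_ltn_trans ki ir.
  have xk : x \notin A (u k).
    by apply: (@nth_find _ j0 (fun j => x \notin A j)); rewrite has_find.
  move: ki; rewrite leq_eqVlt => /orP[/eqP <- //|/key_lt/(_ ir)].
  rewrite /key (negPf xk); case: ifP => // xi.
  by have [_ ? _ _] := wA _ xi; lia.
have k_gt0 : 0 < k.
  rewrite lt0n; apply/eqP=> k0.
  have := uN (index j0 e); rewrite k0 index_mem me => /(_ isT isT).
  by rewrite /u nth_index // xj0.
have k_le : k <= size e by apply: find_size.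
have WP i : i < k ->
    [/\ 0 < a (u i), a (u i) <= (size q).+1 & b (u i) < a (u i)].
  by case/uW/wA.
have NP i : k <= i -> i < size e ->
    [/\ 0 < a (u i), a (u i) <= b (u i) & b (u i) <= size q].
  by move=> ki /(uN _ ki)/nA[].
have WW i j : i < j -> j < k -> a (u i) < a (u j) /\ b (u i) < b (u j).
  move=> ij jk; have xi := uW _ (ltn_trans ij jk); have xj := uW _ jk.
  have := key_lt i j ij; rewrite {1 2}/key xi xj => /(_ (leq_trans jk k_le)) aij.
  split=> //; rewrite ltnNge; apply/negP=> bb.
  by have := cmpW _ _ xi xj (ltnW aij) bb => uij; rewrite uij ltnn in aij.
have NN i j : k <= i -> i < j -> j < size e ->
    a (u i) < a (u j) /\ b (u i) < b (u j).
  move=> ki ij jr; have xi := uN _ ki (ltn_trans ij jr).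
  have xj := uN _ (leq_trans ki (ltnW ij)) jr.
  have := key_lt i j ij jr; rewrite /key (negPf xi) (negPf xj) ltn_add2r => aij.
  split=> //; rewrite ltnNge; apply/negP=> bb.
  by have := cmpN _ _ xi xj (ltnW aij) bb => uij; rewrite uij ltnn in aij.
have WN i j : i < k -> k <= j -> j < size e ->
    a (u j) < a (u i) /\ b (u i) < b (u j).
  by move=> ik kj jr; apply: cmpNW; [apply: uW|apply: uN].
have WPr i : 1 < size e -> i < k -> (b (u i)).+1 < a (u i).
  by rewrite se => J1 ik; apply: properW => //; apply: uW.
have [F [sF acF FI]] :=
  sorted_contract_interval_family (a := a \o u) (b := b \o u) uq qE
    k_gt0 k_le WP NP WW NN WN WPr sq.
exists (size e).-1, F; split=> // I IE.
rewrite -FI //.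
apply: (partial_transversalE (h := fun j => index j e)).
- by move=> j l eqi; rewrite -(nth_index j0 (me j)) eqi nth_index.
- by move=> j; rewrite index_mem.
- by move=> i ir; exists (u i); rewrite index_uniq.
move=> j; rewrite /sorted_sets /= /u nth_index //; case: ltnP => jk.
  by have := uW _ jk; rewrite /u nth_index // => /wA[].
by have := uN _ jk; rewrite index_mem me /u nth_index // => /(_ isT)/nA[].
Qed.

Theorem theorem3p5 (T : finType) (M : matroid T) (x : T) :
  x \in ground M -> multi_path M -> multi_path (contract M x).
Proof.
move=> xE [s [J [A [cs sA acA [AE presA]]]]].
have [q [uq sq qE]] := cyclic_perm_fcycle cs xE.
have cs' : cyclic_perm (ground (contract M x)) (contract_perm s x).
  apply: cyclic_perm_contract uq sq qE _ => y yE.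
  by case: cs => /out_perm -> //.
exists (contract_perm s x).
have [/existsP[j0 xj0]|/existsPn nx] := boolP [exists j, x \in A j].
  have [r [F [sF acF FI]]] := contract_interval_family uq sq qE sA acA xj0.
  have FE i : F i \subset ground M :\ x.
    have [f [m [fE _ ->]]] := sF i; apply/subsetP=> y.
    rewrite inE => /trajectP[n _ ->]; rewrite -permX.
    case: cs' => son _; elim: n => [|n IHn]; first by rewrite expg0 perm1.
    by rewrite expgSr permM (perm_closed _ son).
  exists 'I_r, F; split=> //; split=> // I; rewrite [_ \in _]inE.
  (* Matching [x] to [j0] shows that it is not a loop, so independence of [I] in the contraction is
     that of [x |: I] in [M]. *)
  have -> : [set x] \in indep M.
    apply/presA; exists [set j0], (fun=> x); split.
    - by move=> [j jK] [l lK] _; apply/val_inj => /=; move: jK lK;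
        rewrite !inE => /eqP-> /eqP->.
    - by move=> [j /= jK]; move: (jK); rewrite inE => /eqP->.
    apply/setP=> y; rewrite inE; apply/eqP/imsetP=> [->|[]//].
    by exists (exist _ j0 (set11 j0)).
  have sub : partial_transversal F I -> I \subset ground M :\ x.
    case=> K [f [_ fF ->]]; apply/subsetP=> _ /imsetP[k _ ->].
    exact: subsetP (FE _) _ (fF k).
  split.
    case/andP=> xI xII; apply/FI; last exact/presA.
    rewrite subsetD1 xI andbT; apply: subset_trans (indep_ground xII).
    exact: subsetUr.
  move=> ptI; have IE := sub ptI; apply/andP; split.
    by move: IE; rewrite subsetD1 => /andP[].
  by apply/presA/FI.
(* Here [x] is a loop: no independent set contains it, so the same family presents the
   contraction. *)
have xI I : partial_transversal A I -> x \notin I.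
  case=> K [f [_ fA ->]]; apply/negP=> /imsetP[k _ xf].
  by have /negP := nx (val k); rewrite xf fA.
exists J, A; split=> //.
  move=> j; have [ab] := sigma_interval_pos uq sq qE (sA j).
  by rewrite (negPf (nx j)) => -[a0 ab_le bq ->]; apply: sigma_interval_seg.
split=> [j|I]; first by rewrite subsetD1 AE nx.
rewrite [_ \in _]inE.
have /negPf -> : [set x] \notin indep M.
  by apply/negP=> /presA/xI; rewrite inE eqxx.
split=> [/andP[_ /presA] //|ptI].
by rewrite xI //; apply/presA.
Qed.
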